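(* Let $R$ be a finite Frobenius ring, let $V=R^n$, and let $G$ be a finite permutation group on the coordinates of $V$. Let $H$ be a subgroup of $G$ such that $|H|$ has an inverse in $R$, and define the operator $\theta_H := \frac{1}{|H|}\sum_{h\in H} h$ on $V$. If $C$ is a left $G$-code of length $n$ over $R$, then $${}^{\perp}(C\theta_H) = \ker\theta_H \oplus ({}^{\perp}C)\theta_H .$$
   Context: A finite (associative, unital) ring $R$ is Frobenius if $R/\mathrm{Rad}(R)\cong \mathrm{Soc}(R_R)$ as right $R$-modules and $R/\mathrm{Rad}(R)\cong\mathrm{Soc}({}_RR)$ as left $R$-modules. $R$ need not be commutative. On $V=R^n$ put $(u,v):=u_1v_1+\cdots+u_nv_n$. A permutation group $G$ on the coordinate set $\{1,\dots,n\}$ acts on $V$ on the right by $(vg)_i = v_{ig^{-1}}$. A left $G$-code of length $n$ over $R$ is a left $R$-submodule $C$ of $V$ with $Cg\subseteq C$ for all $g\in G$. ''$|H|$ has an inverse in $R$'' means $|H|\cdot 1_R$ is a unit. For $v\in V$, $v\theta_H=\frac1{|H|}\sum_{h\in H}vh$; for $X\subseteq V$, $X\theta_H=\{v\theta_H: v\in X\}$; $\ker\theta_H=\{v\in V: v\theta_H=0\}$. For a submodule $X\subseteq V$, ${}^{\perp}X:=\{u\in V: (u,v)=0 \text{ for all } v\in X\}$. The sum is an internal direct sum inside $V$. *)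

(* Defs.v *)
From HB Require Import structures.
From mathcomp Require Import all_boot all_fingroup all_algebra.

Set Implicit Arguments.
Unset Strict Implicit.
Unset Printing Implicit Defensive.

Import GRing.Theory.
Local Open Scope ring_scope.

Section FrobeniusRings.
Variable R : finNzRingType.
Implicit Types I S : {set R}.

Definition left_ideal I : bool :=
  (0 \in I) && [forall a, forall x in I, forall y in I, a * x + y \in I].

Definition right_ideal I : bool :=
  (0 \in I) && [forall a, forall x in I, forall y in I, x * a + y \in I].

(* The Jacobson radical; maximal right ideals have the same intersection. *)
Definition Rad : {set R} :=
  \bigcap_(M : {set R} | maxset [pred I | left_ideal I & I != setT] M) M.

(* With P := left_ideal (resp. right_ideal), the simple submodules of R as a
   left (resp. right) module over itself are the minimal nonzero I such that
   P I. *)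
Definition simple_ideal (P : pred {set R}) (S : {set R}) : bool :=
  minset [pred I | P I & I != [set 0]] S.

(* The sum of all the simple ideals. The values of f elsewhere are not used. *)
Definition socle (P : pred {set R}) : {set R} :=
  [set \sum_(S | simple_ideal P S) (f : {ffun {set R} -> R}) S
     | f in [pred f : {ffun {set R} -> R} |
              [forall (S : {set R} | simple_ideal P S), f S \in S]]].

Definition Soc_left : {set R} := socle left_ideal.
Definition Soc_right : {set R} := socle right_ideal.

Definition add_coset (I : {set R}) (x : R) : {set R} := [set x + y | y in I].

Definition quotient_set (I : {set R}) : {set {set R}} :=
  [set add_coset I x | x : R].

(* The operations of R / I are (x + I) + (y + I) = (x + y) + I and
   a(x + I) = ax + I, resp. (x + I)a = xa + I. The values of phi outside
   R / I are not used. *)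
Definition quotient_iso_left I S : Prop :=
  exists phi : {set R} -> R,
    [/\ {in quotient_set I &, injective phi},
        phi @: quotient_set I = S,
        forall x y : R, phi (add_coset I (x + y))
                        = phi (add_coset I x) + phi (add_coset I y)
      & forall a x : R, phi (add_coset I (a * x)) = a * phi (add_coset I x)].

Definition quotient_iso_right I S : Prop :=
  exists phi : {set R} -> R,
    [/\ {in quotient_set I &, injective phi},
        phi @: quotient_set I = S,
        forall x y : R, phi (add_coset I (x + y))
                        = phi (add_coset I x) + phi (add_coset I y)
      & forall x a : R, phi (add_coset I (x * a)) = phi (add_coset I x) * a].

Definition Frobenius_ring : Prop :=
  quotient_iso_right Rad Soc_right /\ quotient_iso_left Rad Soc_left.

End FrobeniusRings.

Section GroupCodes.
Variables (R : finUnitRingType) (n : nat).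
Local Notation V := 'rV[R]_n.
Implicit Types (u v : V) (X A B W C : {set V}) (G H : {group 'S_n}).

Definition dot_prod u v : R := \sum_(i < n) u 0 i * v 0 i.

(* A right action, since (s * t) i = t (s i) for s, t : 'S_n. *)
Definition coord_act v (g : 'S_n) : V := \row_i v 0 ((g^-1)%g i).

Definition left_code G C : Prop :=
  GRing.submod_closed C /\ {in C & G, forall v g, coord_act v g \in C}.

(* Meaningful when #|H|%:R is a unit; it is central, so scaling on the left or
   on the right by its inverse is the same. *)
Definition theta H v : V := (#|H|%:R : R)^-1 *: \sum_(h in H) coord_act v h.

Definition ker_theta H : {set V} := [set v | theta H v == 0].

Definition left_perp X : {set V} := [set u | [forall v in X, dot_prod u v == 0]].

(* W is the internal direct sum of its left submodules A and B. *)
Definition internal_direct_sum W A B : Prop :=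
  [/\ GRing.submod_closed A, GRing.submod_closed B,
      W = [set a + b | a in A, b in B] & A :&: B = [set 0]].

End GroupCodes.

(* Main.v *)
(** The form is invariant under coordinate permutations and [1/|H|] is central,
    so [theta H] is self-adjoint; it is also an idempotent [R]-linear map. Hence
    [u] lies in the left annihilator of [theta H @: C] iff [theta H u] lies in
    that of [C], and [u = (u - theta H u) + theta H u] is the required
    decomposition. *)
Require Import Defs.
From mathcomp Require Import all_boot all_fingroup all_algebra.
Import GRing.Theory.
Local Open Scope ring_scope.

Section Theta.
Variables (R : finUnitRingType) (n : nat).
Implicit Types (a : R) (u v w : 'rV[R]_n) (g h : 'S_n) (H : {group 'S_n}).
Implicit Types C X : {set 'rV[R]_n}.

Lemma coord_act_linear g a u v :
  coord_act (a *: u + v) g = a *: coord_act u g + coord_act v g.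
Proof. by apply/rowP => i; rewrite !mxE. Qed.

Lemma coord_actM v g h : coord_act v (g * h)%g = coord_act (coord_act v g) h.
Proof. by apply/rowP => i; rewrite !mxE invMg permM. Qed.

Lemma coord_actZ g a u : coord_act (a *: u) g = a *: coord_act u g.
Proof. by apply/rowP => i; rewrite !mxE. Qed.

Lemma dot_prod_linear a u v w :
  dot_prod (a *: u + v) w = a * dot_prod u w + dot_prod v w.
Proof.
rewrite /dot_prod mulr_sumr -big_split /=; apply: eq_bigr => i _.
by rewrite !mxE mulrDl mulrA.
Qed.

Lemma dot_prod0l w : dot_prod 0 w = 0.
Proof. by rewrite /dot_prod big1 // => i _; rewrite mxE mul0r. Qed.

Lemma dot_prod_suml (I : Type) (r : seq I) (P : pred I) (F : I -> 'rV[R]_n) w :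
  dot_prod (\sum_(i <- r | P i) F i) w = \sum_(i <- r | P i) dot_prod (F i) w.
Proof.
rewrite /dot_prod exchange_big /=; apply: eq_bigr => i _.
by rewrite summxE mulr_suml.
Qed.

Lemma dot_prod_sumr (I : Type) (r : seq I) (P : pred I) (F : I -> 'rV[R]_n) w :
  dot_prod w (\sum_(i <- r | P i) F i) = \sum_(i <- r | P i) dot_prod w (F i).
Proof.
rewrite /dot_prod exchange_big /=; apply: eq_bigr => i _.
by rewrite summxE mulr_sumr.
Qed.

Lemma dot_prodZl a u w : dot_prod (a *: u) w = a * dot_prod u w.
Proof. by rewrite -[a *: u]addr0 dot_prod_linear dot_prod0l addr0. Qed.

(** In the second argument a scalar lands between [u 0 i] and [w 0 i]; over a noncommutative ring it
    can be moved to the front only if it is central. *)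
Lemma dot_prodZr_central a u w :
  (forall b : R, GRing.comm a b) -> dot_prod u (a *: w) = a * dot_prod u w.
Proof.
move=> ca; rewrite /dot_prod mulr_sumr; apply: eq_bigr => i _.
by rewrite !mxE mulrA -ca mulrA.
Qed.

(** Permuting both arguments by [g] only reorders the sum, so the adjoint of [g] is its inverse. *)
Lemma dot_prod_coord_act u v g :
  dot_prod (coord_act u g) v = dot_prod u (coord_act v g^-1%g).
Proof.
rewrite /dot_prod (reindex_inj (@perm_inj _ g)) /=; apply: eq_bigr => i _.
by rewrite !mxE permK invgK.
Qed.

Lemma theta_linear H a u v :
  theta H (a *: u + v) = a *: theta H u + theta H v.
Proof.
(* The left scalar [a] has to pass the factor 1/|H|, which is central since it inverts an integer
   multiple of 1. *)
have ca : GRing.comm a (#|H|%:R : R)^-1 by apply/commrV/commr_nat.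
rewrite /theta scalerA ca -scalerA -scalerDr; congr (_ *: _).
rewrite scaler_sumr -big_split /=.
by apply: eq_bigr => h _; apply: coord_act_linear.
Qed.

Lemma theta0 H : theta H (0 : 'rV[R]_n) = 0.
Proof.
rewrite /theta big1 ?scaler0 // => h _.
by apply/rowP => i; rewrite !mxE.
Qed.

Lemma thetaB H u v : theta H (u - v) = theta H u - theta H v.
Proof. by rewrite -[in LHS]scaleN1r addrC theta_linear scaleN1r addrC. Qed.

(** The adjoint of the sum over [H] is the sum of the inverses, and inversion permutes [H]. *)
Lemma dot_prod_theta H u v : dot_prod (theta H u) v = dot_prod u (theta H v).
Proof.
have ca b : GRing.comm (#|H|%:R : R)^-1 b.
  by apply/commr_sym/commrV/commr_nat.
rewrite /theta dot_prodZl dot_prodZr_central // dot_prod_suml dot_prod_sumr.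
congr (_ * _); rewrite (reindex_inj invg_inj) /=.
by apply: eq_big => h; rewrite ?groupV // dot_prod_coord_act invgK.
Qed.

(** Right translation by [g] permutes [H], hence the summands of [theta]. *)
Lemma coord_act_theta H v g : g \in H -> coord_act (theta H v) g = theta H v.
Proof.
move=> Hg; rewrite /theta coord_actZ; congr (_ *: _).
rewrite [RHS](reindex_inj (mulIg g)) /=.
apply/rowP => i; rewrite mxE !summxE.
by apply: eq_big => h; rewrite ?groupMr // coord_actM !mxE.
Qed.

Lemma theta_idem H v :
  (#|H|%:R : R) \is a GRing.unit -> theta H (theta H v) = theta H v.
Proof.
move=> uH; rewrite {1}/theta.
(* All |H| summands of the outer average equal [theta H v], so the factor 1/|H| cancels. *)
under eq_bigr => h Hh do rewrite coord_act_theta //.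
by rewrite sumr_const -scaler_nat scalerA mulVr // scale1r.
Qed.

Lemma theta_code (G : {group 'S_n}) H C v :
  H \subset G -> left_code G C -> v \in C -> theta H v \in C.
Proof.
move=> /subsetP sHG [[C0 Clin] Cact] Cv.
have: \sum_(h in H) coord_act v h \in C.
  apply: (big_rec (fun x => x \in C)) => // h x /sHG Gh Cx.
  by rewrite -[coord_act v h]scale1r Clin ?Cact.
(* Closure is stated for [a *: u + v]; a pure scaling is the case [v = 0]. *)
by rewrite /theta => Cs; rewrite -[_ *: _]addr0 Clin.
Qed.

Lemma left_perpP X u :
  reflect (forall v, v \in X -> dot_prod u v = 0) (u \in left_perp X).
Proof.
rewrite inE; apply: (iffP forall_inP) => uX v Xv; last by rewrite uX.
exact/eqP/uX.
Qed.

Lemma left_perp_submod X : GRing.submod_closed (left_perp X).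
Proof.
split=> [|a u v /left_perpP uX /left_perpP vX].
  by apply/left_perpP => v _; apply: dot_prod0l.
by apply/left_perpP => w Xw; rewrite dot_prod_linear uX ?vX // mulr0 addr0.
Qed.

Lemma ker_theta_submod H : GRing.submod_closed (@ker_theta R n H).
Proof.
split=> [|a u v]; rewrite !inE ?theta0 // => /eqP u0 /eqP v0.
by rewrite theta_linear u0 v0 scaler0 addr0.
Qed.

Lemma theta_imset_submod H X :
  GRing.submod_closed X -> GRing.submod_closed (theta H @: X).
Proof.
move=> [X0 Xlin]; split=> [|a _ _ /imsetP[u Xu ->] /imsetP[v Xv ->]].
  by rewrite -(theta0 H) imset_f.
by rewrite -theta_linear imset_f ?Xlin.
Qed.

Lemma left_perp_theta H X u :
  (u \in left_perp (theta H @: X)) = (theta H u \in left_perp X).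
Proof.
apply/left_perpP/left_perpP => uX v.
  by move=> Xv; rewrite dot_prod_theta uX ?imset_f.
by case/imsetP=> w Xw ->; rewrite -dot_prod_theta uX.
Qed.

End Theta.

Theorem theorem3p1 (R : finUnitRingType) (n : nat) (G H : {group 'S_n})
    (C : {set 'rV[R]_n}) :
  Frobenius_ring R ->
  H \subset G ->
  (#|H|%:R : R) \is a GRing.unit ->
  left_code G C ->
  internal_direct_sum (left_perp (theta H @: C))
    (ker_theta R H) (theta H @: left_perp C).
Proof.
move=> _ sHG uH codeC; split.
- exact: ker_theta_submod.
- exact/theta_imset_submod/left_perp_submod.
- apply/setP => u; rewrite left_perp_theta; apply/idP/imset2P.
    move=> Cu; exists (u - theta H u) (theta H u); last by rewrite subrK.
      by rewrite inE thetaB theta_idem // subrr.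
    (* By idempotence [theta H u], which annihilates [C] by [Cu], is its own image under
       [theta H]. *)
    by rewrite -[theta H u]theta_idem // imset_f.
  case=> a b; rewrite inE => /eqP a0 /imsetP[w /left_perpP wC ->] ->.
  (* [theta H] kills [a] and fixes [theta H w]. What remains annihilates [C] because [w] does and
     [theta H] maps [C] into itself. *)
  rewrite -[a]scale1r theta_linear a0 scaler0 add0r theta_idem //.
  apply/left_perpP => c Cc.
  by rewrite dot_prod_theta wC // (theta_code R n G).
- apply/setP => u; rewrite !inE; apply/andP/eqP => [[/eqP u0 /imsetP[w _ uw]]|->].
    (* A vector of the image is fixed by [theta H], and one of the kernel is sent to 0, so
       [u = theta H u = 0]. *)
    by rewrite uw -theta_idem // -uw.
  have [im0 _] := theta_imset_submod R n H _ (left_perp_submod R n C).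
  by split; rewrite ?theta0.
Qed.
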